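(* If $X$ is a connected Tychonoff space, then every cut point of $X$ is a cut point of the Stone-Čech compactification $\beta X$ (where $X$ is regarded as a subspace of $\beta X$).
   Context: A point $x$ of a connected space $Z$ is a cut point of $Z$ if $Z\setminus\{x\}$ is disconnected. *)

(* Defs.v *)
From HB Require Import structures.
From mathcomp Require Import all_boot all_order all_algebra.
From mathcomp Require Import all_classical all_reals all_analysis.

Set Implicit Arguments.
Unset Strict Implicit.
Unset Printing Implicit Defensive.

Import Order.TTheory GRing.Theory Num.Theory.
Import numFieldNormedType.Exports.

Local Open Scope classical_set_scope.
Local Open Scope ring_scope.

Definition cut_point (Z : topologicalType) (x : Z) : Prop :=
  connected [set: Z] /\ ~ connected [set~ x].

(* [completely_regular_space] does not include any separation of points; by
   [uniform_separatorP] it says that a point and a closed set not containing it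
   are separated by a continuous function to [0, 1]. *)
Definition tychonoff_space (X : topologicalType) : Prop :=
  hausdorff_space X /\ completely_regular_space X.

Section StoneCech.
Context (R : realType) (X : topologicalType).

Definition unit_segment : topologicalType := set_type `[(0 : R), 1].

Definition stone_cech_cube : topologicalType :=
  prod_topology (fun _ : continuousType X unit_segment => unit_segment).

Definition stone_cech_eval : X -> stone_cech_cube :=
  join_product (fun f : continuousType X unit_segment => f : X -> unit_segment).

(* The closure of the image of X in the cube [0, 1]^C(X, [0, 1]); elements of X
   are identified with their images under [stone_cech_embed]. *)
Definition stone_cech : topologicalType :=
  set_type (closure (range stone_cech_eval)).

Lemma stone_cech_evalP (x : X) :
  stone_cech_eval x \in closure (range stone_cech_eval).
Proof. by apply/mem_set/subset_closure; exists x. Qed.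

Definition stone_cech_embed (x : X) : stone_cech :=
  exist _ (stone_cech_eval x) (stone_cech_evalP x).

End StoneCech.

Arguments stone_cech_eval R {X} x.
Arguments stone_cech_embed R {X} x.

Lemma set_val_continuous (T : topologicalType) (A : set T) :
  continuous (set_val : set_type A -> T).
Proof. exact: initial_continuous. Qed.

Lemma set_type_compact (T : topologicalType) (A : set T) :
  compact A -> compact [set: set_type A].
Proof.
move=> cA F FF _.
have FA : (set_val @ F) A.
  rewrite /= nbhs_simpl /=.
  by rewrite (_ : _ @^-1` _ = setT) ?nbhs_simpl; [exact: filterT | apply/seteqP; split => // y _; exact: set_valP].
have [p [Ap clp]] := cA (set_val @ F) _ FA.
exists (exist _ p (mem_set Ap)); split => // B V FB [_ [[W oW <-] /= Wp WV]].
have Fv : (set_val @ F) (set_val @` B).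
  by rewrite /= nbhs_simpl /=; apply: filterS FB => b Bb; exists b.
have [_ [[b Bb <-] Wb]] := clp _ W Fv (open_nbhs_nbhs (conj oW Wp)).
by exists b; split => //; apply: WV.
Qed.

Lemma set_type_hausdorff (T : topologicalType) (A : set T) :
  hausdorff_space T -> hausdorff_space (set_type A).
Proof.
move=> hT p q clpq; apply/val_inj/hT => U V Up Vq.
have [r [Ur Vr]] := clpq _ _ (set_val_continuous Up) (set_val_continuous Vq).
by exists (set_val r).
Qed.

(* [stone_cech R X] is a compact Hausdorff space in which a Tychonoff space X
   embeds densely, and every continuous map from X to a compact Hausdorff space
   extends to it; this determines it up to a unique homeomorphism over X, so the
   choice of the real field R is immaterial. *)
Section StoneCechTheory.
Context (R : realType).

Lemma unit_segment_compact : compact [set: unit_segment R].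
Proof. exact/set_type_compact/segment_compact. Qed.
Lemma unit_segment_hausdorff : hausdorff_space (unit_segment R).
Proof. exact/set_type_hausdorff/norm_hausdorff. Qed.

Lemma stone_cech_cube_proj_continuous (X : topologicalType) (f : continuousType X (unit_segment R)) :
  continuous (fun p : stone_cech_cube R X => p f).
Proof. exact: (@proj_continuous _ (fun _ : continuousType X (unit_segment R) => unit_segment R) f). Qed.

Lemma stone_cech_cube_continuous (T X : topologicalType) (g : T -> stone_cech_cube R X) :
  (forall f, continuous (fun t => g t f)) -> continuous g.
Proof.
move=> h t; apply/cvg_sup => f A [_ [[W oW <-] /= Wp WA]].
apply: (filterS WA).
exact: (h f t W (open_nbhs_nbhs (conj oW Wp))).
Qed.

Lemma stone_cech_coord_continuous (X : topologicalType) (f : continuousType X (unit_segment R)) :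
  continuous (fun q : stone_cech R X => (set_val q : stone_cech_cube R X) f).
Proof.
move=> q; apply: (@continuous_comp _ _ _ (set_val : stone_cech R X -> stone_cech_cube R X)
  (fun p : stone_cech_cube R X => p f)); first exact: set_val_continuous.
exact: stone_cech_cube_proj_continuous.
Qed.

Lemma stone_cech_cube_compact (X : topologicalType) : compact [set: stone_cech_cube R X].
Proof.
have := @tychonoff _ (fun _ : continuousType X (unit_segment R) => unit_segment R)
   (fun=> setT) (fun=> unit_segment_compact).
congr (compact _); by apply/seteqP; split.
Qed.

Lemma stone_cech_cube_hausdorff (X : topologicalType) : hausdorff_space (stone_cech_cube R X).
Proof. exact: (@hausdorff_product _ (fun _ : continuousType X (unit_segment R) => unit_segment R) (fun=> unit_segment_hausdorff)). Qed.

Lemma stone_cech_compact (X : topologicalType) : compact [set: stone_cech R X].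
Proof.
apply/set_type_compact/(subclosed_compact (@closed_closure _ _) (@stone_cech_cube_compact X)).
by [].
Qed.

Lemma stone_cech_hausdorff (X : topologicalType) : hausdorff_space (stone_cech R X).
Proof. exact/set_type_hausdorff/stone_cech_cube_hausdorff. Qed.

Lemma stone_cech_embed_dense (X : topologicalType) : dense (range (@stone_cech_embed R X)).
Proof.
move=> O [p Op] [W oW WO]; have /set_mem clp := valP p.
have Wp : W (val p) by move: Op; rewrite -WO.
have [_ [[x _ <-] Wx]] := clp W (open_nbhs_nbhs (conj oW Wp)).
by exists (stone_cech_embed R x); split; [rewrite -WO|exists x].
Qed.

Lemma stone_cech_embed_continuous (X : topologicalType) : continuous (@stone_cech_embed R X).
Proof.
apply: continuous_comp_initial; apply: stone_cech_cube_continuous => f; exact: cts_fun.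
Qed.

Lemma unit_segment_separation (X : topologicalType) (x : X) (B : set X) : completely_regular_space X ->
  closed B -> ~ B x -> exists f : continuousType X (unit_segment R),
   set_val (f x) = 0 /\ forall b, B b -> set_val (f b) = 1.
Proof.
move=> cr clB Bx; have /uniform_separatorP := cr x B clB Bx.
move=> /(_ R)[f [cf f01 fx fB]].
have fI y : f y \in `[0, 1]%classic by apply/mem_set/f01; exists y.
pose g (y : X) : unit_segment R := exist _ (f y) (fI y).
have cg : continuous g by apply: continuous_comp_initial.
exists (mkcts cg : continuousType X (unit_segment R)); split.
  by apply: fx; exists x.
by move=> b Bb; apply: fB; exists b.
Qed.

Lemma stone_cech_embed_inj (X : topologicalType) : tychonoff_space X ->
  injective (@stone_cech_embed R X).
Proof.
move=> [hX cX] x y exy; apply: contrapT => xy.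
have cl1 : closed [set y] by apply/accessible_closed_set1/hausdorff_accessible.
have [f [fx fy]] := unit_segment_separation cX cl1 xy.
have /(congr1 (fun p => set_val (set_val p f))) := exy.
by rewrite /= fx fy// => /esym/eqP; rewrite oner_eq0.
Qed.

Lemma stone_cech_embed_initial (X : topologicalType) : tychonoff_space X ->
  forall U : set X, open U <-> exists2 V, open V & @stone_cech_embed R X @^-1` V = U.
Proof.
move=> [hX cX] U; split=> [oU|[V oV <-]]; last first.
  by apply: open_comp => // + _; exact: stone_cech_embed_continuous.
pose V := [set p : stone_cech R X | exists (f : continuousType X (unit_segment R)),
  (forall y, ~ U y -> set_val (f y) = 1) /\ set_val (set_val p f) < 1].
exists V.
  rewrite openE => p [f [fU pf]].
  have : \forall q \near p, set_val (set_val q f) < 1.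
    have c : continuous (fun q : stone_cech R X => set_val (set_val q f)).
      move=> q; apply: (@continuous_comp _ _ _ (fun q : stone_cech R X => (set_val q : stone_cech_cube R X) f) (set_val : unit_segment R -> R)).
        exact: stone_cech_coord_continuous.
      exact: set_val_continuous.
    have := c p [set z | z < 1]; apply.
    by apply: open_nbhs_nbhs; split => //; exact: open_lt.
  by apply: filterS => q qf; exists f.
apply/seteqP; split => [x [f [fU]]|x Ux].
  by move=> /= lt; apply: contrapT => /fU E; move: lt; rewrite [X in X < _]E ltxx.
have [|f [fx f1]] := @unit_segment_separation X x (~` U) cX (open_closedC oU); first exact.
by exists f; split => //=; rewrite [X in X < _]fx ltr01.
Qed.

Lemma stone_cech_extend (X K : topologicalType) (f : X -> K) :
  compact [set: K] -> hausdorff_space K -> continuous f ->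
  exists2 g : stone_cech R X -> K, continuous g & g \o @stone_cech_embed R X = f.
Proof.
move=> cK hK cf.
have tK : tychonoff_space K.
  split => //; apply: (@normal_completely_regular R); first exact: compact_normal.
  exact: hausdorff_accessible.
have eK := @stone_cech_embed_continuous K.
have clr : range (@stone_cech_embed R K) = setT.
  have clo : closed (range (@stone_cech_embed R K)).
    apply: (compact_closed (@stone_cech_hausdorff K)); apply: continuous_compact => //.
    exact: continuous_subspaceT.
  apply/seteqP; split => // p _; apply: clo => V Vp.
  move: Vp; rewrite nbhsE => -[Q [oO Op] OV].
  have [q [Oq rq]] := stone_cech_embed_dense (ex_intro _ p Op) oO.
  by exists q; split => //; exact: OV.
pose cft : continuousType X K := mkcts cf.
pose F (p : stone_cech R X) : stone_cech_cube R K :=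
  fun h => set_val p (h \o cft : continuousType X (unit_segment R)).
have cF : continuous F.
  by apply: stone_cech_cube_continuous => h; exact: stone_cech_coord_continuous.
have FX x : F (stone_cech_embed R x) = stone_cech_eval R (f x) by [].
have Fr p : F p \in closure (range (@stone_cech_eval R K)).
  apply/mem_set => V FV.
  have := cF p V FV; rewrite nbhs_simpl /= nbhsE => -[Q [oO Op] OV].
  have [y [Oq [x _ xq]]] := stone_cech_embed_dense (ex_intro _ p Op) oO.
  exists (F (stone_cech_embed R x)); split; first by exists (f x).
  by apply: OV; rewrite xq.
pose G p : stone_cech R K := exist _ (F p) (Fr p).
have cG : continuous G by apply: continuous_comp_initial.
have ex p : exists k, stone_cech_embed R k = G p.
  have : setT (G p) by exact: I.
  rewrite -clr  => -[k _ ?]; by exists k.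
pose g p := projT1 (cid (ex p)).
have gP p : stone_cech_embed R (g p) = G p by rewrite /g; case: cid.
exists g.
  apply/continuousP => U /(stone_cech_embed_initial tK)[V oV <-].
  rewrite (_ : _ @^-1` _ = G @^-1` V); first by apply: open_comp.
  by apply/seteqP; split => p /=; rewrite gP.
apply/funext => x /=; apply: (stone_cech_embed_inj tK); rewrite gP.
exact: eq_sig_hprop.
Qed.
End StoneCechTheory.

(* Main.v *)
(** A separation [U], [V] of [X \ {x}] consists of open sets, so the map of [X] collapsing [V] to
    [x] is continuous and extends to [beta X].  The extension is the identity on the closure of
    [U] and is constant, equal to [x], on the closure of [V]; hence these closures, which cover
    [beta X \ {x}], meet at most in [x]. *)
Require Import Defs.
From mathcomp Require Import all_boot all_order all_algebra.
From mathcomp Require Import all_classical all_reals all_analysis.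

Set Implicit Arguments.
Unset Strict Implicit.
Unset Printing Implicit Defensive.

Local Open Scope classical_set_scope.

(** Any neighbourhoods of [f y] and [g y] share a value [f z = g z] with [z] in [A] close to [y], so
    they cannot be disjoint. *)
Lemma eq_on_closure (S T : topologicalType) (f g : S -> T) (A : set S) :
  hausdorff_space T -> continuous f -> continuous g ->
  (forall y, A y -> f y = g y) -> forall y, closure A y -> f y = g y.
Proof.
move=> hT cf cg fg y clAy; apply: hT => P Q Pfy Qgy.
have [z [Az [Pz Qz]]] : A `&` (f @^-1` P `&` g @^-1` Q) !=set0.
  by apply: clAy; apply: filterI; [exact: cf|exact: cg].
by exists (f z); split => //; rewrite fg.
Qed.

(** The complement of [U] is [closure V] together with [x], a union of two closed sets, because
    [closure V] misses [U]. *)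
Lemma separated_open (X : topologicalType) (x : X) (U V : set X) :
  closed [set x] -> [set~ x] = U `|` V -> separated U V -> open U.
Proof.
move=> clx xUV [_ UclV].
suff -> : U = ~` (closure V `|` [set x]).
  exact/closed_openC/closedU/clx/closed_closure.
apply/seteqP; split=> [y Uy [clVy|yx]|y /not_orP[clVy yx]].
- by have : (U `&` closure V) y by []; rewrite UclV.
- by have : [set~ x] y by rewrite xUV; left.
- by have : [set~ x] y by []; rewrite xUV => -[//|/subset_closure].
Qed.

Definition collapse {X : Type} (V : set X) (x y : X) : X :=
  if `[< V y >] then x else y.

(** The preimage of an open [W] is the union of [W] and [V] if [x] lies in [W], and the intersection
    of [W] and [U] otherwise. *)
Lemma collapse_continuous (X : topologicalType) (x : X) (U V : set X) :
  open U -> open V -> [set~ x] = U `|` V -> U `&` V = set0 ->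
  continuous (collapse V x).
Proof.
move=> oU oV xUV UV0; apply/continuousP => W oW.
have [Wx|nWx] := pselect (W x).
  suff -> : collapse V x @^-1` W = W `|` V by exact: openU.
  by apply/seteqP; split=> y; rewrite /collapse /=; case: asboolP; tauto.
suff -> : collapse V x @^-1` W = W `&` U by exact: openI.
apply/seteqP; split=> y; rewrite /collapse /=; case: asboolP => // Vy.
  move=> Wy; split=> //; have : [set~ x] y by move=> yx; rewrite -yx in nWx.
  by rewrite xUV => -[].
by move=> [_ Uy]; have : (U `&` V) y by []; rewrite UV0.
by case.
Qed.

Lemma closure_range_stone_cech_embed (R : realType) (X : topologicalType) :
  closure (range (@stone_cech_embed R X)) = [set: stone_cech R X].
Proof.
apply/seteqP; split=> // p _ N; rewrite nbhsE => -[Q [oQ Qp] QN].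
have [q [Qq rq]] := @stone_cech_embed_dense R X Q (ex_intro _ p Qp) oQ.
by exists q; split=> //; exact: QN.
Qed.

Lemma stone_cech_connected (R : realType) (X : topologicalType) :
  connected [set: X] -> connected [set: stone_cech R X].
Proof.
move=> cX; rewrite -closure_range_stone_cech_embed.
apply: connected_closure; apply: connected_continuous_connected => //.
exact/continuous_subspaceT/stone_cech_embed_continuous.
Qed.

Lemma closure_stone_cech_embedI (R : realType) (X : topologicalType) (x : X)
    (U V : set X) :
  open U -> open V -> [set~ x] = U `|` V -> U `&` V = set0 ->
  closure (stone_cech_embed R @` U) `&` closure (stone_cech_embed R @` V)
    `<=` [set stone_cech_embed R x].
Proof.
move=> oU oV xUV UV0 p [clU clV].
set e := @stone_cech_embed R X.
have ce : continuous e := @stone_cech_embed_continuous R X.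
have cc : continuous (e \o collapse V x).
  move=> y; apply: continuous_comp; last exact: ce.
  exact: (collapse_continuous oU oV xUV UV0).
have hB := @stone_cech_hausdorff R X.
(* Extension needs a compact Hausdorff target, so the collapse is first composed with [e]; [r] is
   then a self-map of [stone_cech R X]. *)
have [r cr re] := @stone_cech_extend R _ _ _ (@stone_cech_compact R X) hB cc.
have reE y : r (e y) = e (collapse V x y) by rewrite -[LHS]/((r \o e) y) re.
have cid : continuous (@id (stone_cech R X)) by move=> y; exact: cvg_id.
(* Since [p] is in both closures, [r p] is computed twice: as [p] from the side of [U], as [e x]
   from the side of [V]. *)
have <- : r p = p.
  apply: (eq_on_closure hB cr cid _ clU) => _ [y Uy <-].
  rewrite reE /collapse; case: asboolP => // Vy.
  by have : (U `&` V) y by []; rewrite UV0.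
apply: (eq_on_closure hB cr (@cst_continuous _ _ (e x)) _ clV) => _ [y Vy <-].
by rewrite reE /collapse; case: asboolP.
Qed.

Theorem theorem3p1 (R : realType) (X : topologicalType)
  (X_tychonoff : tychonoff_space X) (X_connected : connected [set: X]) (x : X) :
  cut_point x -> cut_point (stone_cech_embed R x).
Proof.
move=> [_ /connectedPn[E [E0 xE sepE]]]; split; first exact: stone_cech_connected.
have clx : closed [set x].
  by apply/accessible_closed_set1/hausdorff_accessible; case: X_tychonoff.
have oF : open (E false) := separated_open clx xE sepE.
have oT : open (E true).
  by apply: (separated_open clx (V := E false)); [rewrite setUC|rewrite separatedC].
set e := @stone_cech_embed R X.
have EI : E false `&` E true = set0 by exact: separated_disjoint.
have clEI := closure_stone_cech_embedI (R := R) oF oT xE EI.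
(* The two closures can share only [e x]; deleting it yields the separation. *)
pose F b := closure (e @` E b) `\ e x.
have sF b : closure (F b) `<=` closure (e @` E b).
  rewrite [X in _ `<=` X](closure_id _).1; last exact: closed_closure.
  by apply: closureS; exact: subDsetl.
apply/connectedPn; exists F; split.
(* Injectivity of [e] keeps the image of a point of [E b] away from [e x]. *)
- move=> b; have [y Ey] := E0 b; exists (e y); split.
    by apply: subset_closure; exists y.
  move=> /(stone_cech_embed_inj X_tychonoff) yx.
  have : [set~ x] y by rewrite xE; case: b Ey; [right|left].
  exact.
(* By density every point lies in the closure of the range of [e], and splitting off [x] adds only
   the closed set of the single point [e x]. *)
- rewrite -setDUl -closureU -image_setU -xE; apply/seteqP; split=> [p px|p []//].
  split=> //; have : closure (range e) p by rewrite closure_range_stone_cech_embed.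
  have -> : range e = e @` [set~ x] `|` [set e x].
    by rewrite -[X in _ `|` X]image_set1 -image_setU setUC setUv.
  rewrite closureU => -[//|].
  suff -> : closure [set e x] = [set e x] by [].
  apply/esym/closure_id/accessible_closed_set1/hausdorff_accessible.
  exact: stone_cech_hausdorff.
- split; apply/seteqP; split=> // p.
    by move=> [/sF clF [clT px]]; apply: px; exact: clEI.
  by move=> [[clF px] /sF clT]; apply: px; exact: clEI.
Qed.
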